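(* For objective functions $E$ defined by the recursive scheme $E(\mathit{DL}(\mathit{ys}))=f(\mathit{ys})$, $E(\mathit{DN}(u,r,v))=g\big(E(\mathit{mapD}_{\cap r^{+}}(u)),E(\mathit{mapD}_{\cap r^{-}}(v))\big)$ with $g(a,b)\ge\max(a,b)$, the one-step recursive processes of $\mathit{sodt}_{\text{vec}}$ (adding a rule to a leaf via $\mathit{update}$) and of $\mathit{sodt}_{\text{kperms}}$ (inserting a rule into a permutation via $\mathit{insR}$) are not monotonic in general. That is: (1) the implication $E(t)\le E(t')\Rightarrow E(\mathit{update}(r,t))\le E(\mathit{update}(r,t'))$ does not hold in general: there exist such an objective $E$, a data list, a list of rules with ancestry relation matrix, a rule $r$ and trees $t,t'$ (for which both updates are defined) violating it; (2) the implication $E(\mathit{rs})\le E(\mathit{rs}')\Rightarrow E(\mathit{insR}(r,\mathit{rs}))\le E(\mathit{insR}(r,\mathit{rs}'))$ does not hold in general: there exist such an objective $E$, a data list, a list of rules with ancestry relation matrix, a rule $r$, valid permutations $\mathit{rs},\mathit{rs}'$ and valid results of inserting $r$ into them violating it.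
   Context: Data points lie in $\mathbb{R}^{D}$; a data list is a finite list of data points. A splitting rule $r$ determines two disjoint complementary regions $r^{+},r^{-}$ of $\mathbb{R}^{D}$. Trees are either a leaf $\mathit{DL}(\mathit{ys})$ carrying a data list, or a node $\mathit{DN}(u,r,v)$ with left subtree $u$, rule $r$, right subtree $v$. $\mathit{ys}\cap S$ is the sublist of elements of $\mathit{ys}$ lying in $S$, and $\mathit{mapD}_{\cap S}$ replaces the data list $\mathit{ys}$ in each leaf of a tree by $\mathit{ys}\cap S$. In the objective, $f$ maps data lists to $\mathbb{R}$ and $g:\mathbb{R}\times\mathbb{R}\to\mathbb{R}$; data points may carry labels on which $f$ depends (e.g. the 0-1 loss, where $f$ counts the points of a leaf not in its majority class and $g(a,b)=a+b$). The ancestry relation matrix $\boldsymbol{K}$ of a list of rules has entries in $\{1,0,-1\}$ with zero diagonal; $\boldsymbol{K}_{sr}=1$ (resp. $-1$) means that $r$ may be placed in the left (resp. right) subtree of $s$, and $\boldsymbol{K}_{sr}=0$ means that $s$ cannot be an ancestor of $r$. $\mathit{update}(r,t)$ adds rule $r$ to the appropriate leaf of $t$: $\mathit{update}(r,\mathit{DL}(\mathit{ys}))=\mathit{DN}(\mathit{DL}(\mathit{ys}\cap r^{+}),r,\mathit{DL}(\mathit{ys}\cap r^{-}))$; $\mathit{update}(r,\mathit{DN}(u,s,v))$ is $\mathit{DN}(\mathit{update}(r,u),s,v)$ if $\boldsymbol{K}_{sr}=1$, $\mathit{DN}(u,s,\mathit{update}(r,v))$ if $\boldsymbol{K}_{sr}=-1$,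 and undefined if $\boldsymbol{K}_{sr}=0$ or if the recursive update is undefined. A permutation (list without repetition) $[r_1,\dots,r_k]$ of rules is valid for data list $\mathit{xs}$ if successively applying $\mathit{update}(r_1,\cdot),\dots,\mathit{update}(r_k,\cdot)$ starting from $\mathit{DL}(\mathit{xs})$ is always defined; its $E$-value is the $E$-value of the resulting tree. $\mathit{insR}(r,\mathit{rs})$ is a (nondeterministic) list obtained by inserting $r$ at an arbitrary position of $\mathit{rs}$. *)

(* Defs.v *)
From HB Require Import structures.
From mathcomp Require Import all_boot all_order all_algebra.
From mathcomp Require Import boolp classical_sets reals.

Set Implicit Arguments.
Unset Strict Implicit.
Unset Printing Implicit Defensive.

Import Order.TTheory GRing.Theory Num.Theory.
Local Open Scope classical_set_scope.
Local Open Scope ring_scope.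

(** A data point is a position in R^D together with a label in [L];
    [L := unit] gives unlabelled data. *)
Definition datum (R : realType) (D : nat) (L : Type) : Type :=
  ('rV[R]_D * L)%type.

Record rule (R : realType) (D : nat) := Rule {
  rpos : set 'rV[R]_D;
  rneg : set 'rV[R]_D;
  rule_disjoint : rpos `&` rneg = set0;
  rule_cover : rpos `|` rneg = setT }.

(** Classical decidable equality, so that lists of rules have [\in] and [uniq]. *)
HB.instance Definition _ (R : realType) (D : nat) := gen_eqMixin (rule R D).

Section Trees.
Context {R : realType} {D : nat} {L : Type}.

Definition cap (S : set 'rV[R]_D) (ys : seq (datum R D L)) :
    seq (datum R D L) :=
  [seq y <- ys | y.1 \in S].

Inductive tree : Type :=
| DL of seq (datum R D L)
| DN of tree & rule R D & tree.

Fixpoint mapD (h : seq (datum R D L) -> seq (datum R D L)) (t : tree) : tree :=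
  match t with
  | DL ys => DL (h ys)
  | DN u r v => DN (mapD h u) r (mapD h v)
  end.

(** The node equation recurses on [mapD _ u], not on [u] itself, so [E] is
    specified by its equations; since [mapD] preserves the shape of a tree,
    they have exactly one solution for given [f] and [g]. *)
Record objective (f : seq (datum R D L) -> R) (g : R -> R -> R)
    (E : tree -> R) : Prop := Objective {
  objective_leaf : forall ys, E (DL ys) = f ys;
  objective_node : forall u r v,
    E (DN u r v) = g (E (mapD (cap (rpos r)) u)) (E (mapD (cap (rneg r)) v));
  objective_ge_max : forall a b, Num.max a b <= g a b }.

(** Rows and columns of the matrix are indexed by the rules themselves; entries
    at rules outside [rules] are irrelevant. *)
Definition ancestry_matrix (rules : seq (rule R D))
    (K : rule R D -> rule R D -> int) : Prop :=
  {in rules &, forall s r, K s r \in [:: 1; 0; -1]} /\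
  {in rules, forall r, K r r = 0}.

(** [None] means undefined. *)
Fixpoint update (K : rule R D -> rule R D -> int) (r : rule R D) (t : tree) :
    option tree :=
  match t with
  | DL ys => Some (DN (DL (cap (rpos r) ys)) r (DL (cap (rneg r) ys)))
  | DN u s v =>
      if K s r == 1 then omap (fun u' => DN u' s v) (update K r u)
      else if K s r == -1 then omap (fun v' => DN u s v') (update K r v)
      else None
  end.

(** [rs = [:: r_1; ...; r_k]] is applied from [r_1] to [r_k]. *)
Definition updates (K : rule R D -> rule R D -> int) (rs : seq (rule R D))
    (t : tree) : option tree :=
  foldl (fun ot r => obind (update K r) ot) (Some t) rs.

(** [rs] is a permutation of rules taken from [rules] (not necessarily all of
    them), it is valid for [xs], and [t] is the resulting tree, so that the
    [E]-value of [rs] is [E t]. *)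
Definition valid_perm (rules : seq (rule R D)) (K : rule R D -> rule R D -> int)
    (xs : seq (datum R D L)) (rs : seq (rule R D)) (t : tree) : Prop :=
  [/\ uniq rs, {subset rs <= rules} & updates K rs (DL xs) = Some t].

Definition reachable (rules : seq (rule R D)) (K : rule R D -> rule R D -> int)
    (xs : seq (datum R D L)) (t : tree) : Prop :=
  exists rs, valid_perm rules K xs rs t.

End Trees.

Arguments tree : clear implicits.

(** The nondeterministic insertion as a relation: [rs1] is a possible value of
    insR(r, rs). *)
Definition insR (T : Type) (r : T) (rs rs1 : seq T) : Prop :=
  exists s1 s2 : seq T, rs = s1 ++ s2 /\ rs1 = s1 ++ r :: s2.

(* Main.v *)
(** Take two data points [p] and [q], the loss of a leaf being its number of
    points and [g] the maximum.  The two trivial rules, sending all the points to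
    the left or to the right, give trees of equal value 2.  A rule separating [p]
    from [q] that may only be added to the left of either of them lowers the value
    to 1 when the points are on the left, and splits an empty leaf, to no effect,
    when they are on the right. *)

Require Import Defs.
From HB Require Import structures.
From mathcomp Require Import all_boot all_order all_algebra.
From mathcomp Require Import boolp classical_sets reals.

Set Implicit Arguments.
Unset Strict Implicit.
Unset Printing Implicit Defensive.

Import Order.TTheory GRing.Theory Num.Theory.
Local Open Scope ring_scope.

Local Arguments cap : simpl never.

Section Objective.
Context {R : realType} {D : nat} {L : Type}.
Variables (f : seq (datum R D L) -> R) (g : R -> R -> R).

(* The restrictions met on the way down from the root accumulate in [h], which
   makes the recursion structural. *)
Fixpoint eval_with (h : seq (datum R D L) -> seq (datum R D L))
    (t : tree R D L) : R :=
  match t with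
  | DL ys => f (h ys)
  | DN u r v => g (eval_with (cap (rpos r) \o h) u)
                  (eval_with (cap (rneg r) \o h) v)
  end.

Lemma eval_with_mapD h k t : eval_with h (mapD k t) = eval_with (h \o k) t.
Proof. by elim: t h => //= u IHu r v IHv h; rewrite IHu IHv. Qed.

Lemma objective_eval_with :
  (forall a b, Num.max a b <= g a b) -> objective f g (eval_with id).
Proof. by move=> g_ge; split=> // u r v; rewrite !eval_with_mapD. Qed.

End Objective.

(** The regions are the set of [P] and its complement. Describing them through [cap] as boolean
    filters lets restrictions of concrete lists compute. *)
Lemma rule_of_pred (R : realType) (D : nat) (L : Type) (P : pred 'rV[R]_D) :
  exists2 r : rule R D,
    forall ys : seq (datum R D L), cap (rpos r) ys = [seq y <- ys | P y.1]
  & forall ys : seq (datum R D L), cap (rneg r) ys = [seq y <- ys | ~~ P y.1].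
Proof.
have in_P x : (x \in [set` P]%classic) = P x by apply/idP/idP; rewrite in_setE.
exists (Rule (classical_sets.setICr [set` P]%classic)
             (classical_sets.setUCr [set` P]%classic)) => ys.
  by apply: eq_filter => y; rewrite in_P.
by apply: eq_filter => y; rewrite /= in_setC in_P.
Qed.

Theorem theorem9 (R : realType) (D : nat) (hD : (0 < D)%N)
    (L : Type) (hL : inhabited L) :
  (exists (f : seq (datum R D L) -> R) (g : R -> R -> R)
          (E : tree R D L -> R)
          (xs : seq (datum R D L))
          (rules : seq (rule R D)) (K : rule R D -> rule R D -> int)
          (r : rule R D) (t t' t1 t1' : tree R D L),
      objective f g E /\
      uniq rules /\ ancestry_matrix rules K /\ r \in rules /\
      reachable rules K xs t /\ reachable rules K xs t' /\
      update K r t = Some t1 /\ update K r t' = Some t1' /\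
      ~ (E t <= E t' -> E t1 <= E t1'))
  /\
  (exists (f : seq (datum R D L) -> R) (g : R -> R -> R)
          (E : tree R D L -> R)
          (xs : seq (datum R D L))
          (rules : seq (rule R D)) (K : rule R D -> rule R D -> int)
          (r : rule R D) (rs rs' rs1 rs1' : seq (rule R D))
          (t t' t1 t1' : tree R D L),
      objective f g E /\
      uniq rules /\ ancestry_matrix rules K /\ r \in rules /\
      valid_perm rules K xs rs t /\ valid_perm rules K xs rs' t' /\
      insR r rs rs1 /\ insR r rs' rs1' /\
      valid_perm rules K xs rs1 t1 /\ valid_perm rules K xs rs1' t1' /\
      ~ (E t <= E t' -> E t1 <= E t1')).
Proof.
have [l] := hL.
pose p : 'rV[R]_D := 0; pose q : 'rV[R]_D := const_mx 1.
(* [0 < D] provides a coordinate in which the two points differ. *)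
have qNp : q != p.
  by apply/eqP => /rowP /(_ (Ordinal hD)); rewrite !mxE; apply/eqP/oner_neq0.
pose xs : seq (datum R D L) := [:: (p, l); (q, l)].
pose f (ys : seq (datum R D L)) : R := (size ys)%:R.
pose E := eval_with f Num.max id.
have objE : objective f Num.max E by exact: objective_eval_with.
have [a capa capNa] := rule_of_pred L (predT : pred 'rV[R]_D).
have [b capb capNb] := rule_of_pred L (pred0 : pred 'rV[R]_D).
have [r capr capNr] := rule_of_pred L (pred1 p).
pose capE := (capa, capNa, capb, capNb, capr, capNr).
(* The rules are told apart by the part of [xs] they send left: both points for [a], none for [b],
   only [p] for [r]. *)
have aNb : a != b.
  by apply/eqP => /(congr1 (fun s => cap (rpos s) xs)); rewrite !capE.
have aNr : a != r.
  apply/eqP => /(congr1 (fun s => cap (rpos s) xs)).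
  by rewrite !capE /= eqxx (negbTE qNp).
have bNr : b != r.
  apply/eqP => /(congr1 (fun s => cap (rpos s) xs)).
  by rewrite !capE /= eqxx.
pose rules := [:: a; b; r].
have uniq_rules : uniq rules by rewrite /= !inE negb_or aNb aNr bNr.
(* Among [rules] the only nonzero entries are [K a r = K b r = 1]: [r] may go below [a] or [b],
   always on the left. *)
pose K (s s' : rule R D) : int := ((s != r) && (s' == r))%:R.
have KP : ancestry_matrix rules K.
  by split=> [s s' _ _|s _]; rewrite /K ?andNb //; case: (_ && _).
have Kr s : s != r -> K s r == 1 by rewrite /K eqxx => ->.
pose leaf_split s := @DN R D L (DL (cap (rpos s) xs)) s (DL (cap (rneg s) xs)).
pose left_split s := DN (DN (DL (cap (rpos r) (cap (rpos s) xs))) r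
  (DL (cap (rneg r) (cap (rpos s) xs)))) s (DL (cap (rneg s) xs)).
have Eb : E (leaf_split b) = 2%:R by rewrite /E /f /= !capE /= max_r ?ler0n.
have Ea : E (leaf_split a) = 2%:R by rewrite /E /f /= !capE /= max_l ?ler0n.
(* The leaf split by [r] is empty and both points stay on the right: the value is max(max(0, 0),
   2). *)
have Eb1 : E (left_split b) = 2%:R.
  by rewrite /E /f /= !capE /= maxxx max_r ?ler0n.
(* Here [r] splits the full leaf into two singletons: max(max(1, 1), 0). The filters are evaluated
   twice because [E] restricts the leaves again. *)
have Ea1 : E (left_split a) = 1.
  by rewrite /E /f /= !capE /= eqxx (negbTE qNp) /= eqxx qNp maxxx max_l.
have not_mono :
    ~ (E (leaf_split b) <= E (leaf_split a) -> E (left_split b) <= E (left_split a)).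
  by rewrite Eb Ea Eb1 Ea1 => /(_ (lexx _)); rewrite (ler_nat R 2 1).
have upd s : s != r -> update K r (leaf_split s) = Some (left_split s).
  by move=> sNr; rewrite /= Kr.
have ar : a \in rules by rewrite !inE eqxx.
have br : b \in rules by rewrite !inE eqxx orbT.
have rr : r \in rules by rewrite !inE eqxx !orbT.
have valid1 s : s \in rules -> valid_perm rules K xs [:: s] (leaf_split s).
  by move=> srules; split=> // s'; rewrite inE => /eqP ->.
have valid2 s : s \in rules -> s != r ->
    valid_perm rules K xs [:: s; r] (left_split s).
  move=> srules sNr; split; first by rewrite /= inE sNr.
    by move=> s' /predU1P[->|/predU1P[->|]].
  by rewrite /updates /= Kr.
split.
  exists f, Num.max, E, xs, rules, K, r, (leaf_split b), (leaf_split a),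
    (left_split b), (left_split a).
  have reach s : s \in rules -> reachable rules K xs (leaf_split s).
    by exists [:: s]; exact: valid1.
  by do ![split; first by [| exact: reach | exact: upd]].
(* Inserting [r] at the end amounts to one [update], so the trees of the first part serve again. *)
exists f, Num.max, E, xs, rules, K, r, [:: b], [:: a], [:: b; r], [:: a; r],
  (leaf_split b), (leaf_split a), (left_split b), (left_split a).
have ins s : insR r [:: s] [:: s; r] by exists [:: s], [::].
by do ![split; first by [| exact: ins | exact: valid1 | exact: valid2]].
Qed.
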